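(* Assume that the virtual element ingredients $\mathcal T_h$, $V_h$, $A_h$, $f_h$ satisfy Assumptions (A1) and (A2) stated in the context, and let $a_h=\sum_{E\in\mathcal T_h}a_h^E$ and $b_h=\sum_{E\in\mathcal T_h}b_h^E$. Then the problem: find $u_h\in V_h$ such that $$a_h(u_h,v_h)+b_h(u_h,v_h)=\langle f_h,v_h\rangle\qquad\forall v_h\in V_h,$$ possesses a unique solution.
   Context: **Continuous problem.** $\Omega\subset\mathbb R^d$, $d\in\{2,3\}$, is a polygonal ($d=2$) or polyhedral ($d=3$) domain. The coefficients $\kappa_{ij},\beta_i,\gamma$ are in $L^\infty(\Omega)$, $f\in L^\infty(\Omega)$, $\nabla\cdot\beta\in L^\infty(\Omega)$; $\kappa(x)$ is a symmetric $d\times d$ tensor and there are $\kappa_*,\kappa^*>0$ with $\kappa_*|v(x)|^2\le v(x)\cdot\kappa(x)v(x)\le\kappa^*|v(x)|^2$ for a.e. $x\in\Omega$ and all $v\in(H^1_0(\Omega))^d$; and $\mu(x):=\gamma(x)-\frac12\nabla\cdot\beta(x)\ge\mu_0\ge0$ for a.e. $x$, for some constant $\mu_0$. Set, on an element $E$, $$a^E(u,v)=\int_E\kappa\nabla u\cdot\nabla v\,dx+\int_E\mu uv\,dx,\quad b^E(u,v)=\tfrac12\int_E\big[(\beta\cdot\nabla u)v-u(\beta\cdot\nabla v)\big]dx.$$ **Notation.** $\mathcal P_\ell(E)$ is the space of polynomials of degree at most $\ell$ on $E$; $\Pi_\ell:L^2(E)\to\mathcal P_\ell(E)$ is the $L^2(E)$-orthogonal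 projection (componentwise on vector fields). $H^1(\mathcal T_h)=\{v\in L^2(\Omega): v|_E\in H^1(E)\ \forall E\in\mathcal T_h\}$, $|v|_{1,h}^2=\sum_E\|\nabla v\|_{0,E}^2$. $\|\cdot\|_{0,\Omega}$ and $\|\cdot\|_{1,E}$ are the $L^2(\Omega)$ and $H^1(E)$ norms. $\langle\cdot,\cdot\rangle$ is the duality pairing between $V_h'$ and $V_h$. **Assumption (A1).** For fixed $h>0$ and integer $k\ge1$ we are given: - a finite decomposition (mesh) $\mathcal T_h$ of $\Omega$ into non-overlapping simple polygonal/polyhedral elements (with non-self-intersecting boundary) of maximum size $h$, where the boundary of each element consists of a uniformly bounded number of interfaces (edges if $d=2$, faces if $d=3$), each either part of $\partial\Omega$ or shared with another element; - a finite dimensional space $V_h\subset H^1(\mathcal T_h)$ (not necessarily contained in $H_0^1(\Omega)$) such that $\|v_h\|_{0,\Omega}^2\le C_{PF}|v_h|_{1,h}^2$ for all $v_h\in V_h$ (so $|\cdot|_{1,h}$ is a norm on $V_h$), and such that for each $E$ the local space $V_h^E:=V_h|_E$ contains $\mathcal P_k(E)$; - a bilinear form $A_h:V_h\times V_h\to\mathbb R$ with $A_h(u_h,v_h)=\sum_{E}A_h^E(u_h,v_h)$, $A_h^E$ a bilinear form on $V_h^E$; - an element $f_h\in V_h'$ approximating the forcing term. **Assumption (A2).** $A_h^E=a_h^E+b_h^E$ with $a_h^E$ symmetric and $b_h^E$ skew-symmetric bilinear forms on $V_h^E$ satisfying: - *Polynomial consistency*: if $u_h\in\mathcal P_k(E)$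 or $v_h\in\mathcal P_k(E)$, then $$a_h^E(u_h,v_h)=\int_E\kappa\,\Pi_{k-1}(\nabla u_h)\cdot\Pi_{k-1}(\nabla v_h)\,dx+\int_E\mu\,\Pi_ku_h\,\Pi_kv_h\,dx,$$ $$b_h^E(u_h,v_h)=\tfrac12\int_E\beta\cdot\big[\Pi_{k-1}(\nabla u_h)\Pi_kv_h-\Pi_ku_h\,\Pi_{k-1}(\nabla v_h)\big]dx.$$ - *Stability*: there are positive constants $\alpha_*,\alpha^*,C_b$ independent of $h$ and $E$ such that for all $v_h,w_h\in V_h^E$: $\alpha_*a^E(v_h,v_h)\le a_h^E(v_h,v_h)\le\alpha^*a^E(v_h,v_h)$, $b_h^E(v_h,v_h)=0$, and $b_h^E(v_h,w_h)\le C_b\|v_h\|_{1,E}\|w_h\|_{1,E}$. *)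

(* Defs.v *)
From HB Require Import structures.
From mathcomp Require Import all_boot all_order all_algebra.
From mathcomp Require mpoly.
From mathcomp Require Import all_classical all_reals all_analysis.

Set Implicit Arguments.
Unset Strict Implicit.
Unset Printing Implicit Defensive.

Import Order.TTheory GRing.Theory Num.Theory.
Import numFieldNormedType.Exports.

Local Open Scope classical_set_scope.
Local Open Scope ring_scope.

(* As for [n.-tuple T] in the library, 'rV[R]_n carries the sigma-algebra
   generated by the coordinates; for R^n this is the Borel sigma-algebra. *)

Definition rV_display : measure_display.
Proof. exact: default_measure_display. Qed.

Section measurable_rV.
Context {R : realType} {n : nat}.

Definition rV_coord (i : 'I_n) (x : 'rV[R]_n) : R := x ord0 i.

Let rV_set0 : g_sigma_preimage rV_coord set0.
Proof. exact: sigma_algebra0. Qed.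

Let rV_setC A : g_sigma_preimage rV_coord A -> g_sigma_preimage rV_coord (~` A).
Proof. exact: sigma_algebraC. Qed.

Let rV_bigcup (F : (set 'rV[R]_n)^nat) :
  (forall i, g_sigma_preimage rV_coord (F i)) ->
  g_sigma_preimage rV_coord (\bigcup_i (F i)).
Proof. exact: sigma_algebra_bigcup. Qed.

HB.instance Definition _ := @isMeasurable.Build rV_display 'rV[R]_n
  (g_sigma_preimage rV_coord) rV_set0 rV_setC rV_bigcup.

Lemma measurable_rV_coord i : measurable_fun [set: 'rV[R]_n] (rV_coord i).
Proof.
move=> _ Y mY; rewrite setTI; apply: sub_sigma_algebra => /=.
rewrite -bigcup_seq/=; exists i => /=; first by rewrite mem_index_enum.
by exists Y => //; rewrite setTI.
Qed.

Lemma measurable_fun_rVP d (T : measurableType d) (f : T -> 'rV[R]_n) :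
  (forall i, measurable_fun [set: T] (fun t => rV_coord i (f t))) ->
  measurable_fun [set: T] f.
Proof.
move=> mf _ A mA; rewrite setTI.
have : g_sigma_preimage rV_coord `<=` [set B | measurable (f @^-1` B)].
  apply: smallest_sub.
    split; first by rewrite /= preimage_set0.
      by move=> B mB; rewrite /= setTD -preimage_setC; exact: (measurableC mB).
    by move=> F mF; rewrite /= preimage_bigcup; apply: bigcup_measurable => j _; exact: mF.
  rewrite -bigcup_seq; apply: bigcup_sub => i _ B [C mC <-] /=.
  by have := mf i measurableT C mC; rewrite !setTI.
by apply.
Qed.

End measurable_rV.

Definition rV_cons {R : realType} n (p : 'rV[R]_n * R) : 'rV[R]_n.+1 :=
  \row_(i < n.+1) oapp (fun j => p.1 ord0 j) p.2 (unlift ord0 i).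

Lemma measurable_rV_cons {R : realType} n :
  measurable_fun [set: 'rV[R]_n * R] (@rV_cons R n).
Proof.
apply: measurable_fun_rVP => i.
rewrite (_ : (fun _ => _) = fun p : 'rV[R]_n * R =>
    oapp (fun j => p.1 ord0 j) p.2 (unlift ord0 i)); last first.
  by apply/funext => p; rewrite /rV_coord /rV_cons mxE.
case: (unlift ord0 i) => [j|] /=; last exact: measurable_snd.
exact: measurableT_comp (measurable_rV_coord j) measurable_fst.
Qed.

Section lebesgue_rV.
Context (R : realType).

(* The image of m x lebesgue_measure under the identification of R^n x R with
   R^(n+1). *)
Definition lebesgue_rV_step n (m : {measure set 'rV[R]_n -> \bar R}) :
    {measure set 'rV[R]_n.+1 -> \bar R} :=
  measure_function_pushforward__canonical__measure_function_Measure
    (m \x @lebesgue_measure R)%E (@measurable_rV_cons R n).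

Fixpoint lebesgue_rV (n : nat) : {measure set 'rV[R]_n -> \bar R} :=
  match n with
  | 0 => dirac (0 : 'rV[R]_0)
  | m.+1 => lebesgue_rV_step (lebesgue_rV m)
  end.

End lebesgue_rV.

(* Functions on a subset E of R^d are defined on the whole of R^d; only their
   values on E matter. *)

Section function_spaces.
Context {R : realType} {d : nat}.
Implicit Types (E : set 'rV[R]_d) (u v p q phi : 'rV[R]_d -> R)
  (G : 'rV[R]_d -> 'rV[R]_d).

Local Notation leb := (lebesgue_rV R d).

Definition dotV (x y : 'rV[R]_d) : R := \sum_(i < d) x 0 i * y 0 i.

Definition enorm (x : 'rV[R]_d) : R := Num.sqrt (dotV x x).

Definition component G (i : 'I_d) : 'rV[R]_d -> R := fun x => G x 0 i.

Definition in_Linfty E v : Prop :=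
  measurable_fun E v /\
  exists M : R, {ae leb, forall x, E x -> `|v x| <= M}.

Definition in_L2 E v : Prop :=
  measurable_fun E v /\ leb.-integrable E (fun x => (v x ^+ 2)%:E).

Definition partial (i : 'I_d) phi : 'rV[R]_d -> R :=
  fun x => 'D_(delta_mx 0 i) phi x.

Definition smooth phi : Prop :=
  forall (s : seq 'I_d) (x : 'rV[R]_d), differentiable (foldr partial phi s) x.

Definition test_function E phi : Prop :=
  smooth phi /\
  exists K : set 'rV[R]_d,
    [/\ compact K, K `<=` E & forall x, ~ K x -> phi x = 0].

Definition weak_gradient E v G : Prop :=
  forall (i : 'I_d) phi, test_function E phi ->
    \int[leb]_(x in E) (v x * partial i phi x)
    = - \int[leb]_(x in E) (G x 0 i * phi x).

Definition weak_divergence E G v : Prop :=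
  forall phi, test_function E phi ->
    \int[leb]_(x in E) (\sum_(i < d) G x 0 i * partial i phi x)
    = - \int[leb]_(x in E) (v x * phi x).

Definition L2_gradients E v : set ('rV[R]_d -> 'rV[R]_d) :=
  [set G | (forall i, in_L2 E (component G i)) /\ weak_gradient E v G].

Definition in_H1 E v : Prop := in_L2 E v /\ L2_gradients E v !=set0.

(* a representative of the weak gradient of v on E (unique a.e. on E when
   v is in H^1(E)) *)
Definition grad E v : 'rV[R]_d -> 'rV[R]_d :=
  xget (fun=> 0) (L2_gradients E v).

Definition L2_sqnorm E v : R := \int[leb]_(x in E) (v x ^+ 2).

Definition L2V_sqnorm E G : R := \int[leb]_(x in E) (dotV (G x) (G x)).

Definition H1_norm E v : R :=
  Num.sqrt (L2_sqnorm E v + L2V_sqnorm E (grad E v)).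

(* the closure of the test functions for the H^1 norm; the limit G of the
   gradients is the weak gradient of v *)
Definition in_H10 E v : Prop :=
  in_L2 E v /\
  exists (phi : nat -> 'rV[R]_d -> R) (G : 'rV[R]_d -> 'rV[R]_d),
    [/\ forall n, test_function E (phi n),
        forall i, in_L2 E (component G i),
        L2_sqnorm E (phi n \- v) @[n --> \oo] --> 0
      & L2V_sqnorm E (fun x => \row_(i < d) (partial i (phi n) x - G x 0 i))
          @[n --> \oo] --> 0].

(* mdeg m is the total degree of the monomial m *)
Definition polynomial_function (l : nat) p : Prop :=
  exists P : mpoly.mpoly d R,
    all (fun m => mpoly.mdeg m <= l)%N (mpoly.msupp P) /\ p = fun x => mpoly.meval (fun i => x 0 i) P.

Definition in_P E (l : nat) v : Prop :=
  exists2 p, polynomial_function l p & {ae leb, forall x, E x -> v x = p x}.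

Definition L2_proj E (l : nat) v : 'rV[R]_d -> R :=
  xget (fun=> 0)
    [set p | polynomial_function l p /\
      forall q, polynomial_function l q ->
        \int[leb]_(x in E) ((v x - p x) * q x) = 0].

Definition L2V_proj E (l : nat) G : 'rV[R]_d -> 'rV[R]_d :=
  fun x => \row_(i < d) L2_proj E l (component G i) x.

End function_spaces.

Section geometry.
Context {R : realType}.

Definition boundary {T : topologicalType} (A : set T) : set T :=
  closure A `\` interior A.

Definition convex_hull {n m : nat} (p : 'I_m -> 'rV[R]_n) : set 'rV[R]_n :=
  [set x | exists t : 'I_m -> R,
    [/\ forall j, 0 <= t j, \sum_j t j = 1 & x = \sum_j t j *: p j]].

(* bounded interval if n = 1, polygonal domain if n = 2, polyhedral domain if
   n = 3: the boundary is a finite union of (n-1)-simplices *)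
Definition polytopal_domain {n : nat} (G : set 'rV[R]_n) : Prop :=
  [/\ open G, G !=set0, connected G, bounded_set G
    & interior (closure G) = G /\
      exists (m : nat) (p : 'I_m -> 'I_n -> 'rV[R]_n),
        boundary G = \bigcup_j convex_hull (p j)].

Definition locally_euclidean {n : nat} (m : nat) (S : set 'rV[R]_n) : Prop :=
  forall x, S x -> exists U : set 'rV[R]_n,
    [/\ open U, U x
      & exists (f : 'rV[R]_n -> 'rV[R]_m) (g : 'rV[R]_m -> 'rV[R]_n),
        [/\ {within S `&` U, continuous f}, continuous g,
            forall y, (S `&` U) (g y) /\ f (g y) = y
          & forall z, (S `&` U) z -> g (f z) = z]].

(* the boundary is non-self-intersecting: a closed polygonal curve (d = 2) or a
   closed polyhedral surface (d = 3) which is a topological manifold *)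
Definition simple_polytope {d : nat} (E : set 'rV[R]_d) : Prop :=
  [/\ polytopal_domain E, connected (boundary E)
    & locally_euclidean d.-1 (boundary E)].

(* the relative interior of an edge (d = 2) or of a polygonal face (d = 3); the
   interface itself is its closure *)
Definition open_facet {d : nat} (F : set 'rV[R]_d) : Prop :=
  exists (M : 'M[R]_(d.-1, d)) (b : 'rV[R]_d) (G : set 'rV[R]_d.-1),
    [/\ row_free M, polytopal_domain G & F = (fun y => y *m M + b) @` G].

Definition diameter {d : nat} (E : set 'rV[R]_d) : R :=
  sup [set enorm (z.1 - z.2) | z in E `*` E].

Record mesh {d : nat} (Omega : set 'rV[R]_d) (h : R)
    (I : finType) (T : I -> set 'rV[R]_d) : Prop := {
  mesh_simple : forall i, simple_polytope (T i);
  mesh_sub : forall i, T i `<=` Omega;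
  mesh_cover : closure Omega = \bigcup_i closure (T i);
  mesh_disjoint : forall i j, i != j -> T i `&` T j = set0;
  mesh_size_le : forall i, diameter (T i) <= h;
  mesh_size_max : exists i, diameter (T i) = h;
  mesh_interfaces : exists (nmax : nat) (nf : I -> nat)
      (F : forall i, 'I_(nf i) -> set 'rV[R]_d),
    [/\ forall i, (nf i <= nmax)%N,
        forall i j, open_facet (F i j),
        forall i j j', j != j' -> F i j `&` F i j' = set0,
        forall i, boundary (T i) = \bigcup_j closure (F i j)
      & forall i j, closure (F i j) `<=` boundary Omega \/
          exists i' j', i' != i /\ F i' j' = F i j] }.

End geometry.

Section continuous_problem.
Context {R : realType} {d : nat}.
Local Notation leb := (lebesgue_rV R d).

(* divbeta stands for the weak divergence of beta *)
Record coefficients := Coefficients {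
  kappa : 'rV[R]_d -> 'M[R]_d;
  beta : 'rV[R]_d -> 'rV[R]_d;
  gamma : 'rV[R]_d -> R;
  divbeta : 'rV[R]_d -> R;
  source : 'rV[R]_d -> R }.

Implicit Types (c : coefficients) (E Omega : set 'rV[R]_d)
  (u v : 'rV[R]_d -> R).

(* kappa(x) y, with y a row vector *)
Definition kappaV c (x y : 'rV[R]_d) : 'rV[R]_d := y *m (kappa c x)^T.

Definition mu_coef c (x : 'rV[R]_d) : R := gamma c x - 2^-1 * divbeta c x.

Record continuous_problem Omega c (kappa_lo kappa_hi mu0 : R) : Prop := {
  cp_domain : polytopal_domain Omega;
  cp_kappa : forall i j, in_Linfty Omega (fun x => kappa c x i j);
  cp_beta : forall i, in_Linfty Omega (component (beta c) i);
  cp_gamma : in_Linfty Omega (gamma c);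
  cp_source : in_Linfty Omega (source c);
  cp_divbeta : in_Linfty Omega (divbeta c);
  cp_weak_div : weak_divergence Omega (beta c) (divbeta c);
  cp_symmetric : {ae leb, forall x, Omega x -> (kappa c x)^T = kappa c x};
  cp_kappa_lo : 0 < kappa_lo;
  cp_kappa_hi : 0 < kappa_hi;
  cp_elliptic : forall v : 'rV[R]_d -> 'rV[R]_d,
    (forall i, in_H10 Omega (component v i)) ->
    {ae leb, forall x, Omega x ->
      kappa_lo * enorm (v x) ^+ 2 <= dotV (v x) (kappaV c x (v x))
        <= kappa_hi * enorm (v x) ^+ 2};
  cp_mu0 : 0 <= mu0;
  cp_mu : {ae leb, forall x, Omega x -> mu0 <= mu_coef c x} }.

Definition a_loc c E u v : R :=
  \int[leb]_(x in E) (dotV (kappaV c x (grad E u x)) (grad E v x))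
  + \int[leb]_(x in E) (mu_coef c x * u x * v x).

End continuous_problem.
Arguments coefficients : clear implicits.

(* The space V_h is a finite-dimensional vector space V together with a linear
   map rep choosing a representative of each of its elements; rep is injective
   up to equality almost everywhere on Omega (field A1_inj). *)

Section virtual_elements.
Context {R : realType} {d : nat} (I : finType) (V : vectType R).
Local Notation leb := (lebesgue_rV R d).
Variable rep : {linear V -> ('rV[R]_d -> R^o)}.
Variable T : I -> set 'rV[R]_d.
Implicit Types (Omega E : set 'rV[R]_d) (u v w : V).

Definition in_H1_broken Omega (v : 'rV[R]_d -> R) : Prop :=
  in_L2 Omega v /\ forall i, in_H1 (T i) v.

Definition broken_sqnorm (v : 'rV[R]_d -> R) : R :=
  \sum_i L2V_sqnorm (T i) (grad (T i) v).

(* A bilinear form on the local space V_h|_E is a bilinear form on V_h whose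
   values only depend on the restrictions of its arguments to E. *)
Definition local_form E (B : {biscalar V}) : Prop :=
  forall u u' v, {ae leb, forall x, E x -> rep u x = rep u' x} ->
    B u v = B u' v /\ B v u = B v u'.

Record assumption_A1 Omega (h : R) (k : nat)
    (A : {biscalar V}) (A_E : I -> {biscalar V}) : Prop := {
  A1_h : 0 < h;
  A1_k : (1 <= k)%N;
  A1_mesh : mesh Omega h T;
  A1_inj : forall v,
    {ae leb, forall x, Omega x -> rep v x = 0} -> v = 0;
  A1_H1 : forall v, in_H1_broken Omega (rep v);
  A1_PF : exists C_PF : R, forall v,
    L2_sqnorm Omega (rep v) <= C_PF * broken_sqnorm (rep v);
  A1_polynomials : forall i p, polynomial_function k p ->
    exists v, {ae leb, forall x, T i x -> rep v x = p x};
  A1_local : forall i, local_form (T i) (A_E i);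
  A1_sum : forall u v, A u v = \sum_i A_E i u v }.

Definition a_consistent (c : coefficients R d) (k : nat) E u v : R :=
  let PG w := L2V_proj E k.-1 (grad E (rep w)) in
  let P w := L2_proj E k (rep w) in
  \int[leb]_(x in E) (dotV (kappaV c x (PG u x)) (PG v x))
  + \int[leb]_(x in E) (mu_coef c x * P u x * P v x).

Definition b_consistent (c : coefficients R d) (k : nat) E u v : R :=
  let PG w := L2V_proj E k.-1 (grad E (rep w)) in
  let P w := L2_proj E k (rep w) in
  2^-1 * \int[leb]_(x in E)
    (dotV (beta c x) (P v x *: PG u x - P u x *: PG v x)).

Record assumption_A2 (c : coefficients R d) (k : nat)
    (A_E a_E b_E : I -> {biscalar V}) : Prop := {
  A2_split : forall i u v, A_E i u v = a_E i u v + b_E i u v;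
  A2_a_local : forall i, local_form (T i) (a_E i);
  A2_b_local : forall i, local_form (T i) (b_E i);
  A2_a_sym : forall i u v, a_E i u v = a_E i v u;
  A2_b_skew : forall i u v, b_E i u v = - b_E i v u;
  A2_consistency : forall i u v,
    in_P (T i) k (rep u) \/ in_P (T i) k (rep v) ->
    a_E i u v = a_consistent c k (T i) u v /\
    b_E i u v = b_consistent c k (T i) u v;
  A2_stability : exists alpha_lo alpha_hi C_b : R,
    [/\ 0 < alpha_lo, 0 < alpha_hi, 0 < C_b
      & forall i v w,
        [/\ alpha_lo * a_loc c (T i) (rep v) (rep v) <= a_E i v v,
            a_E i v v <= alpha_hi * a_loc c (T i) (rep v) (rep v),
            b_E i v v = 0
          & b_E i v w <= C_b * H1_norm (T i) (rep v) * H1_norm (T i) (rep w)]]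
}.

Definition sum_form (B : I -> {biscalar V}) u v : R := \sum_i B i u v.

End virtual_elements.

(* Main.v *)
Require Import Defs.
From HB Require Import structures.
From mathcomp Require Import all_boot all_order all_algebra.
From mathcomp Require Import all_classical all_reals all_analysis.
From mathcomp Require Import measurable_realfun ring lra.

(** The discrete problem is a square linear system: V is finite dimensional
    and the bilinear form a_h + b_h acts on V x V, so existence and uniqueness
    for every right-hand side both follow once u = 0 is the only element with
    (a_h + b_h)(u, v) = 0 for all v ([definite_form_solvable]).

    Such a u is tested against itself. The local forms b_h^E vanish on the
    diagonal, so the sum of the a_h^E(u, u) is zero. By stability each
    a_h^E(u, u) dominates a positive multiple of a^E(u, u), which in turn
    dominates kappa_lo |grad u|^2 on E ([a_loc_coercive]). Hence the broken H^1
    seminorm of u vanishes, by the Poincare-Friedrichs inequality so does its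
    L^2(Omega) norm, and u = 0 because representatives of distinct elements of V
    differ on a set of positive measure.

    The delicate point is the coercivity of a^E. Ellipticity of kappa is given
    only along vector fields v in H^1_0(Omega)^d, with an exceptional null set
    that depends on v, while it has to be used along the gradient of a
    discrete function, which need not vanish on the boundary. It is therefore
    upgraded to a statement about all vectors y at almost every x
    ([ae_elliptic]). For a box Q with rational centre and inverse integer
    half-width whose closure lies in Omega, and for a rational vector r, the
    field v = phi_Q r is admissible, where phi_Q is a smooth function that is
    positive exactly on Q; dividing by phi_Q^2 > 0 gives the inequality for y = r
    almost everywhere on Q. There are countably many pairs (Q, r), the boxes
    cover Omega, and rational vectors are dense.

    This needs smooth bump functions. They are products of one-dimensional
    functions exp(-1/t) in affine functions of the coordinates. Their
    derivatives of all orders exist because the algebra generated by the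
    functions t^(-n) exp(-1/t) of affine functions of one coordinate consists of
    differentiable functions and is stable under partial derivatives
    ([flat_algebra_partial]). *)

Set Implicit Arguments.
Unset Strict Implicit.
Unset Printing Implicit Defensive.

Import Order.TTheory GRing.Theory Num.Theory.
Import numFieldNormedType.Exports.

Local Open Scope classical_set_scope.
Local Open Scope ring_scope.

(** * Linear systems in finite dimension *)

(** Testing against a basis of V turns u |-> B u into a linear map from V to a
    space of the same dimension; it is injective by hypothesis, hence onto. *)
Lemma definite_form_solvable (F : fieldType) (V : vectType F) (B : V -> V -> F)
    (f : {scalar V}) :
  (forall u, scalar (B u)) -> (forall v, scalar (B^~ v)) ->
  (forall u, (forall v, B u v = 0) -> u = 0) ->
  exists! u, forall v, B u v = f v.
Proof.
move=> Br Bl Binj.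
pose e := vbasis {:V}; pose n := \dim {:V}.
have eqB g h : scalar g -> scalar h -> (forall i : 'I_n, g e`_i = h e`_i) ->
    forall v, g v = h v :> F.
  move=> gs hs gh v.
  pose gl := GRing.isLinear.Build F V F^o _ g gs.
  pose hl := GRing.isLinear.Build F V F^o _ h hs.
  pose g' : {scalar V} := HB.pack g gl; pose h' : {scalar V} := HB.pack h hl.
  rewrite (coord_vbasis (memvf v)) -[g _]/(g' _) -[h _]/(h' _) !linear_sum.
  by apply: eq_bigr => i _; rewrite !linearZ /= gh.
pose L u : 'rV[F]_n := \row_i B u e`_i.
have Ll : linear L.
  by move=> a u v; apply/rowP => i; rewrite !mxE; exact: Bl.
pose Lm : {linear V -> 'rV[F]_n} := HB.pack L (GRing.isLinear.Build F V 'rV[F]_n _ L Ll).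
have Linj : injective (linfun Lm).
  move=> u v; rewrite !lfunE /= => uv; apply/eqP; rewrite -subr_eq0; apply/eqP.
  have : L (u - v) = 0 by rewrite -[L _]/(Lm _) linearB /= uv subrr.
  move/rowP => L0; apply: Binj; apply: eqB => //.
    by move=> a x y; rewrite mulr0 addr0.
  by move=> i; have := L0 i; rewrite !mxE.
have ker0 : lker (linfun Lm) == 0%VS by apply/lker0P.
have limgT : limg (linfun Lm) = fullv.
  apply/eqP; rewrite eqEdim subvf /= limg_dim_eq ?(eqP ker0) ?capv0//.
  by rewrite dimvf [X in (X <= _)%N]mul1n.
have /memv_imgP[u _ uE] : \row_i f e`_i \in limg (linfun Lm) by rewrite limgT memvf.
exists u; split.
  apply: eqB => [|a x y|i]; [exact: Br|by rewrite linearP|].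
  by move/rowP : uE => /(_ i); rewrite lfunE !mxE.
move=> w wE; apply: Linj; rewrite -uE lfunE; apply/rowP => i.
by rewrite !mxE wE.
Qed.

(** * Functions flat at the origin *)

Section flat.
Context {R : realType}.
Implicit Types (n : nat) (t : R).

(** The family t^(-n) exp(-1/t) is closed under differentiation up to linear
    combinations, which exp(-1/t) alone is not. *)
Definition flat n t : R := if 0 < t then t^-1 ^+ n * expR (- t^-1) else 0.

Lemma flat_gt0 t : 0 < t -> 0 < flat 0 t.
Proof. by move=> t0; rewrite /flat t0 expr0 mul1r expR_gt0. Qed.

Lemma flat_le0 n t : t <= 0 -> flat n t = 0.
Proof. by move=> t0; rewrite /flat ltNge t0. Qed.

(** With s = 1/t this is s^(n+2) <= (n+2)! exp s, a single term of the
    exponential series. It makes the derivative at the origin vanish. *)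
Lemma flat_le_sqr n t : `|flat n t| <= n.+2`!%:R * t ^+ 2.
Proof.
rewrite /flat; case: ifPn => [t0|_]; last by rewrite normr0 mulr_ge0// sqr_ge0.
have ti0 : 0 < t^-1 by rewrite invr_gt0.
have fact0 : (0 : R) < n.+2`!%:R by rewrite ltr0n fact_gt0.
have /le_trans : t^-1 ^+ n.+2 <= n.+2`!%:R * expR t^-1.
  rewrite mulrC -ler_pdivrMr//; apply: le_trans (expR_ge1Dxn n.+1 (ltW ti0)).
  by rewrite lerDr.
rewrite ger0_norm; last by rewrite mulr_ge0 ?exprn_ge0 ?expR_ge0// ltW.
rewrite expRN ler_pdivrMr ?expR_gt0// mulrAC -ler_pdivrMr ?exprn_gt0//.
by rewrite -exprVn -exprD addn2; exact.
Qed.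

Lemma is_derive_flat n t :
  is_derive t 1 (flat n) (flat n.+2 t - n%:R * flat n.+1 t).
Proof.
have [t0|t0|->] := ltgtP t 0.
- rewrite (flat_le0 n.+2 (ltW t0)) (flat_le0 n.+1 (ltW t0)) mulr0 subr0.
  apply: (@near_eq_is_derive _ _ _ (cst 0)).
  by near=> x; rewrite flat_le0// ltW//; near: x; exact: lt_nbhsl.
- have tn0 : t != 0 by rewrite gt_eqF.
  apply: (@near_eq_is_derive _ _ _
    ((GRing.inv : R -> R) ^+ n * (expR \o (fun x => - x^-1)))).
    near=> x; have x0 : 0 < x by near: x; exact: lt_nbhsr.
    by rewrite /flat x0 /GRing.mul/= fctE /=.
  have dV : is_derive t 1 (GRing.inv : R -> R) (- (t ^- 2)).
    apply: (is_derive_eq (is_deriveV _ _)) => //=.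
    by rewrite /GRing.scale/= mulr1.
  have dE : is_derive t 1 (expR \o (fun x : R => - x^-1))
      (expR (- t^-1) * t ^- 2).
    apply: is_derive1_comp.
    apply: (is_derive_eq (is_deriveN _)).
    by rewrite opprK.
  apply: (is_derive_eq (is_deriveM _ _)).
  rewrite /flat t0 fctE /GRing.scale/= -!exprVn.
  case: n => [|n] /=; first by rewrite !expr0 !mul0r; ring.
  by rewrite !exprS; ring.
rewrite (flat_le0 n.+2 (lexx 0)) (flat_le0 n.+1 (lexx 0)) mulr0 subr0.
apply/is_derive1_caratheodory.
(* At the origin the difference quotient is O(x) by the quadratic bound. *)
exists (fun x => flat n x / x); split.
- move=> x; rewrite (flat_le0 n (lexx 0)) !subr0.
  have [->|x0] := eqVneq x 0; last by rewrite divfK.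
  by rewrite mulr0 flat_le0.
- suff : flat n x / x @[x --> 0] --> (0 : R).
    by move=> H z; rewrite (flat_le0 n (lexx 0)) mul0r; exact: H.
  apply/cvgr0Pnorm_le => e e0.
  have fact0 : (0 : R) < n.+2`!%:R by rewrite ltr0n fact_gt0.
  have := @nbhs0_le R R^o (e / n.+2`!%:R) (divr_gt0 e0 fact0).
  apply: filterS => x xe /=.
  have [->|x0] := eqVneq x 0; first by rewrite invr0 mulr0 normr0 ltW.
  rewrite normrM normfV ler_pdivrMr ?normr_gt0//.
  apply: le_trans (flat_le_sqr n x) _.
  rewrite -real_normK ?num_real// expr2 mulrA ler_wpM2r//.
  by rewrite mulrC -ler_pdivlMr.
- by rewrite flat_le0// mul0r.
Unshelve. all: by end_near. Qed.

Lemma differentiable_flat n t : differentiable (flat n) t.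
Proof. by apply/derivable1_diffP; have [] := is_derive_flat n t. Qed.

End flat.

(** * An algebra of smooth functions of several variables *)

Section flat_algebra.
Context {R : realType} {d : nat}.
Implicit Types (f g : 'rV[R]_d -> R) (x : 'rV[R]_d).

(** Smoothness asks for differentiability of every iterated partial derivative;
    this class is what makes an induction on the order of derivation possible. *)
Inductive flat_algebra : ('rV[R]_d -> R) -> Prop :=
| flat_algebra_cst c : flat_algebra (cst c)
| flat_algebra_flat n (i : 'I_d) s a :
    flat_algebra (fun x => flat n (s * x 0 i + a))
| flat_algebraD f g : flat_algebra f -> flat_algebra g -> flat_algebra (f + g)
| flat_algebraM f g : flat_algebra f -> flat_algebra g -> flat_algebra (f * g).

Let differentiable_affine_coord (i : 'I_d) (s a : R) x :
  differentiable (fun y : 'rV[R]_d => s * y 0 i + a) x.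
Proof.
apply: differentiableD; last exact: differentiable_cst.
by apply: differentiableM; [exact: differentiable_cst|exact: differentiable_coord].
Qed.

Let derive_affine_coord (i j : 'I_d) (s a : R) x :
  'D_(delta_mx 0 j) (fun y : 'rV[R]_d => s * y 0 i + a) x = s * (i == j)%:R.
Proof.
have dc : derivable (fun y : 'rV[R]_d => y 0 i : R) x (delta_mx 0 j).
  exact/diff_derivable/differentiable_coord.
have -> : (fun y : 'rV[R]_d => s * y 0 i + a) =
    (s *: (fun y : 'rV[R]_d => y 0 i : R)) + cst a by [].
rewrite deriveD//; last exact: derivableZ.
rewrite derive_cst addr0 deriveZ//= /GRing.scale/=; congr (_ * _).
rewrite /derive; apply: cvg_lim => //.
apply: (@cvg_trans _ ((cst (i == j)%:R : R -> R) @ 0^')); last exact: cvg_cst.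
apply: near_eq_cvg; near=> h.
have h0 : h != 0 by near: h; exact: nbhs_dnbhs_neq.
by rewrite /= !mxE eqxx /= addrK /GRing.scale/= mulrA mulVf// mul1r.
Unshelve. all: by end_near. Qed.

Lemma flat_algebra_differentiable f x : flat_algebra f -> differentiable f x.
Proof.
elim=> [c|n i s a|{}f g _ df _ dg|{}f g _ df _ dg].
- exact: differentiable_cst.
- by have := @differentiable_comp R _ R R _ (flat n) x
    (differentiable_affine_coord i s a x) (differentiable_flat n _).
- exact: differentiableD.
- exact: differentiableM.
Qed.

(** Chain rule on the generators, Leibniz rule on products. *)
Lemma flat_algebra_partial j f : flat_algebra f -> flat_algebra (partial j f).
Proof.
elim=> [c|n i s a|{}f g tf IHf tg IHg|{}f g tf IHf tg IHg].
- rewrite (_ : partial j _ = cst 0); first exact: flat_algebra_cst.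
  by apply/funext => x; rewrite /partial derive_cst.
- pose F m := fun x : 'rV[R]_d => flat m (s * x 0 i + a).
  rewrite (_ : partial j _ =
      cst (s * (i == j)%:R) * (F n.+2 + cst (- n%:R) * F n.+1)).
    apply: flat_algebraM; first exact: flat_algebra_cst.
    apply: flat_algebraD; first exact: flat_algebra_flat.
    by apply: flat_algebraM; [exact: flat_algebra_cst|exact: flat_algebra_flat].
  apply/funext => x; rewrite /partial deriveE; last first.
    exact: (flat_algebra_differentiable _ (flat_algebra_flat _ _ _ _)).
  rewrite (@diff_comp R _ R R (fun y : 'rV[R]_d => s * y 0 i + a) (flat n))//; last first.
    exact: differentiable_flat.
  have E : 'd (fun y : 'rV[R]_d => s * y 0 i + a) x (delta_mx 0 j) =
      (s * (i == j)%:R) *: (1 : R).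
    rewrite -deriveE ?derive_affine_coord//.
    by rewrite /GRing.scale/= mulr1.
  rewrite /= E linearZ /= -deriveE; last exact: differentiable_flat.
  have [_ ->] := is_derive_flat n (s * x 0 i + a).
  by rewrite /F /GRing.mul/= /GRing.add/= mulNr.
- rewrite (_ : partial j _ = partial j f + partial j g).
    exact: flat_algebraD.
  apply/funext => x; rewrite /partial deriveD//;
    exact/diff_derivable/flat_algebra_differentiable.
- rewrite (_ : partial j _ = f * partial j g + g * partial j f).
    by apply: flat_algebraD; apply: flat_algebraM.
  apply/funext => x; rewrite /partial deriveM//;
    exact/diff_derivable/flat_algebra_differentiable.
Qed.

Lemma flat_algebra_smooth f : flat_algebra f -> smooth f.
Proof.
move=> tf s x; apply: flat_algebra_differentiable.
by elim: s => //= j s IHs; exact: flat_algebra_partial.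
Qed.

End flat_algebra.

(** * Boxes and the Lebesgue measure on R^n *)

Lemma norm_le_itv {R : realType} (M : R) : [set t : R | `|t| <= M] = `[- M, M]%classic.
Proof. by apply/seteqP; split=> t /=; rewrite in_itv/= ler_norml. Qed.

Section boxes.
Context {R : realType} {d : nat}.
Implicit Types (q : 'rV[rat]_d * nat) (x : 'rV[R]_d) (O E : set 'rV[R]_d).

Definition rat_box q : set 'rV[R]_d :=
  [set x | forall i, `|x 0 i - ratr (q.1 0 i)| < q.2.+1%:R^-1].

Definition closed_rat_box q : set 'rV[R]_d :=
  [set x | forall i, `|x 0 i - ratr (q.1 0 i)| <= q.2.+1%:R^-1].

(** The rational boxes form a countable base of the topology. Keeping the closed
    box inside the open set leaves room for a compactly supported function. *)
Lemma open_rat_box O x : open O -> O x ->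
  exists q, rat_box q x /\ closed_rat_box q `<=` O.
Proof.
move=> oO Ox; have /nbhs_ballP[e /= e0 eO] := open_nbhs_nbhs (conj oO Ox).
(* The distance to a point of the closed box is at most twice the half-width. *)
have e20 : 0 < e / 2 by rewrite divr_gt0.
have [n _ /(_ n (leqnn n)) /= nlt] := near_infty_natSinv_lt (PosNum e20).
have n0 : (0 : R) < n.+1%:R^-1 by rewrite invr_gt0 ltr0n.
have rat_near i : exists r : rat, `|x 0 i - ratr r| < n.+1%:R^-1.
  have /rat_in_itvoo[r] : x 0 i - n.+1%:R^-1 < x 0 i + n.+1%:R^-1.
    by rewrite ltrD2l gtrN.
  by rewrite in_itv/= => /andP[r1 r2]; exists r; rewrite distrC ltr_distl r1.
pose q i := sval (cid (rat_near i)).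
exists (\row_i q i, n); split.
  by move=> i; rewrite mxE; exact: svalP (cid (rat_near i)).
move=> y yq; apply: eO; split => // i j; rewrite ord1.
rewrite /ball/= (splitr e).
have := yq j; rewrite mxE => yqj.
apply: (le_lt_trans (ler_distD (ratr (q j)) _ _)).
apply: ltrD; first exact: lt_trans (svalP (cid (rat_near j))) nlt.
by rewrite distrC; exact: le_lt_trans yqj nlt.
Qed.

Lemma measurable_rV_box (A : 'I_d -> set R) : (forall i, measurable (A i)) ->
  measurable [set x : 'rV[R]_d | forall i, A i (x 0 i)].
Proof.
move=> mA; rewrite (_ : mkset _ = \bigcap_(i in [set: 'I_d]) (rV_coord i @^-1` A i)).
  apply: fin_bigcap_measurable; first exact: finite_finset.
  move=> i _; rewrite -[X in measurable X]setTI.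
  exact: measurable_rV_coord.
by apply/seteqP; split=> x /= xA i; [move=> _; exact: xA|exact: xA].
Qed.

Lemma measurable_cube (M : R) :
  measurable [set x : 'rV[R]_d | forall i, `|x 0 i| <= M].
Proof.
apply: (@measurable_rV_box (fun=> [set t | `|t| <= M])) => i.
by rewrite norm_le_itv; exact: measurable_itv.
Qed.

Lemma measurable_rat_box q : measurable (rat_box q).
Proof.
apply: (@measurable_rV_box
  (fun i => [set t | `|t - ratr (q.1 0 i)| < q.2.+1%:R^-1])) => i.
rewrite (_ : mkset _ = ball (ratr (q.1 0 i) : R) q.2.+1%:R^-1).
  exact: measurable_ball.
by apply/seteqP; split=> t /=; rewrite /ball/= distrC.
Qed.

(** The sigma-algebra is generated by the coordinates, so open sets are measurable
    because they are countable unions of boxes. *)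
Lemma open_measurable_rV O : open O -> measurable O.
Proof.
move=> oO; pose F q := if `[< closed_rat_box q `<=` O >] then rat_box q else set0.
rewrite (_ : O = \bigcup_q F q).
  apply: countable_bigcupT_measurable => // q.
  by rewrite /F; case: ifP => // _; exact: measurable_rat_box.
apply/seteqP; split=> [x Ox|x [q _]].
  have [q [xq qO]] := open_rat_box oO Ox; exists q => //.
  by rewrite /F; case: asboolP.
by rewrite /F; case: asboolP => // qO xq; apply: qO => i; exact/ltW/xq.
Qed.

Lemma continuous_measurable_rV E (f : 'rV[R]_d -> R) :
  continuous f -> measurable_fun E f.
Proof.
move=> cf; apply: measurable_funTS.
apply: (measurability _ (RGenOInfty.measurableE R)) => _ [_ [a ->] <-].
rewrite setTI; apply: open_measurable_rV.
by apply: open_comp => [x _|]; [exact: cf|exact: interval_open].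
Qed.

End boxes.

(** The measure is built one coordinate at a time and the cube is a product, so
    its measure is a product of finite lengths. *)
Lemma lebesgue_rV_cube_fin {R : realType} n (M : R) :
  (lebesgue_rV R n [set x : 'rV[R]_n | forall i, (`|x 0 i| <= M)%R] < +oo)%E.
Proof.
have fI : (@lebesgue_measure R [set t : R | (`|t| <= M)%R] < +oo)%E.
  by rewrite norm_le_itv lebesgue_measure_itv/=; case: ifP => _; rewrite ?ltry// -EFinB ltry.
elim: n => [|n IHn] /=.
  by rewrite /dirac indicE; case: (_ \in _); rewrite ?ltry.
rewrite /pushforward (_ : _ @^-1` _ =
    [set x : 'rV[R]_n | forall i, `|x 0 i| <= M] `*` [set t | `|t| <= M]).
  rewrite product_measure1E//.
  - by apply: lte_mul_pinfty => //; rewrite ge0_fin_numE.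
  - exact: measurable_cube.
  - by rewrite norm_le_itv; exact: measurable_itv.
apply/seteqP; split=> [[x t]/= xt|[x t]/= [xM tM] i].
  split=> [i|].
    by have := xt (lift ord0 i); rewrite mxE liftK.
  by have := xt ord0; rewrite mxE unlift_none.
by rewrite mxE; case: unliftP => [j _|_] /=; [exact: xM|exact: tM].
Qed.

(** * Bump functions and test functions *)

Section bump.
Context {R : realType} {d : nat}.
Implicit Types (q : 'rV[rat]_d * nat) (x : 'rV[R]_d).

Definition bump q x : R := \prod_(i < d)
  (flat 0 (1 * x 0 i + (q.2.+1%:R^-1 - ratr (q.1 0 i))) *
   flat 0 (-1 * x 0 i + (q.2.+1%:R^-1 + ratr (q.1 0 i)))).

Lemma flat_algebra_bump q : flat_algebra (bump q).
Proof.
rewrite /bump; elim: (index_enum _) => [|i s IHs].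
  under eq_fun do rewrite big_nil.
  exact: flat_algebra_cst.
under eq_fun do rewrite big_cons.
apply: (@flat_algebraM _ _ (fun x => _) (fun x => _)) IHs.
by apply: (@flat_algebraM _ _ (fun x => _) (fun x => _));
  exact: flat_algebra_flat.
Qed.

Lemma bump_gt0 q x : rat_box q x -> 0 < bump q x.
Proof.
have ineq (t c r : R) : `|t - c| < r ->
    0 < 1 * t + (r - c) /\ 0 < -1 * t + (r + c).
  by rewrite ltr_norml => /andP[lo hi]; split; lra.
move=> xq; apply: prodr_gt0 => i _; have [lo hi] := ineq _ _ _ (xq i).
by apply: mulr_gt0; exact: flat_gt0.
Qed.

Lemma bump_eq0 q x : ~ closed_rat_box q x -> bump q x = 0.
Proof.
have ineq (t c r : R) : ~~ (`|t - c| <= r) ->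
    1 * t + (r - c) <= 0 \/ -1 * t + (r + c) <= 0.
  by rewrite ler_norml negb_and -!ltNge => /orP[lo|hi]; [left|right]; lra.
move=> /existsNP[i /negP/ineq xi]; rewrite /bump (bigD1 i)//=.
by case: xi => xi; rewrite (flat_le0 0 xi) ?mulr0 ?mul0r ?mul0r.
Qed.

Lemma compact_closed_rat_box q : compact (@closed_rat_box R d q).
Proof.
apply: (@rV_compact R d
  (fun i => [set t : R | `|t - ratr (q.1 0 i)| <= q.2.+1%:R^-1])) => i.
rewrite (_ : mkset _ =
  `[ratr (q.1 0 i) - q.2.+1%:R^-1, ratr (q.1 0 i) + q.2.+1%:R^-1]%classic).
  exact: segment_compact.
by apply/seteqP; split=> t /=; rewrite in_itv/= ler_distl.
Qed.

Lemma test_function_bump E q a : closed_rat_box q `<=` E ->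
  test_function E (fun x => a * bump q x).
Proof.
move=> qE; split.
  apply: flat_algebra_smooth.
  by apply: (@flat_algebraM _ _ (cst a)); [exact: flat_algebra_cst|exact: flat_algebra_bump].
exists (closed_rat_box q); split => //; first exact: compact_closed_rat_box.
by move=> x /bump_eq0 ->; rewrite mulr0.
Qed.

End bump.

Section test_functions.
Context {R : realType} {d : nat}.
Local Notation leb := (lebesgue_rV R d).
Implicit Types (E : set 'rV[R]_d) (phi : 'rV[R]_d -> R).

(** The support does not grow, since phi is locally constant off the closed set K. *)
Lemma test_function_partial E phi i :
  test_function E phi -> test_function E (partial i phi).
Proof.
move=> [sphi [K [cK KE phi0]]]; split.
  by move=> s x; have := sphi (rcons s i) x; rewrite foldr_rcons.
exists K; split=> // x Kx.
have oK : open (~` K).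
  by apply: closed_openC; apply: compact_closed => //; exact: norm_hausdorff.
rewrite /partial (@near_eq_derive _ _ _ _ (cst 0)) ?derive_cst//.
have : \forall y \near x, (~` K) y by apply: open_nbhs_nbhs.
by apply: filterS => y Ky; rewrite phi0.
Qed.

Lemma test_function_continuous E phi : test_function E phi -> continuous phi.
Proof.
by move=> [sphi _] x; apply: differentiable_continuous; exact: (sphi [::] x).
Qed.

(** A continuous function with compact support is bounded and vanishes outside a
    cube, which has finite measure. *)
Lemma test_function_in_L2 E phi :
  measurable E -> test_function E phi -> in_L2 E phi.
Proof.
move=> mE tphi; have cphi := test_function_continuous tphi.
have [_ [K [cK KE phi0]]] := tphi.
have mphi D : measurable_fun D phi by exact: continuous_measurable_rV.
split=> //.
have [M KM] : exists M, forall x, K x -> `|x| <= M.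
  by have [M [_ KM]] := compact_bounded cK; exists (M + 1); apply: KM; rewrite ltrDl.
have [C phiC] : exists C, forall x, K x -> `|phi x| <= C.
  have [C [_ KC]] : bounded_set (phi @` K).
    apply: compact_bounded; apply: continuous_compact => //.
    exact: continuous_subspaceT.
  by exists (C + 1) => x Kx; apply: (KC (C + 1)); [rewrite ltrDl|exists x].
pose B := [set x : 'rV[R]_d | forall i, `|x 0 i| <= M].
have mB : measurable B by exact: measurable_cube.
have KB : K `<=` B.
  move=> x /KM xM i; apply: le_trans xM.
  rewrite [leRHS]mx_normrE.
  exact: (le_bigmax_cond _ (fun ij => `|x ij.1 ij.2|) (j := (0, i))).
have mEB := measurableI _ _ mE mB.
have iEB : leb.-integrable (E `&` B) (EFin \o (fun x => phi x ^+ 2)).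
  apply: measurable_bounded_integrable => //.
  - by apply: le_lt_trans (lebesgue_rV_cube_fin d M); apply: le_measure;
      rewrite ?inE//; exact: subIsetr.
  - exact: measurable_funX.
  exists (Num.max 0 C ^+ 2); split; first exact: num_real.
  move=> N CN x _ /=; rewrite normrX; apply: le_trans (ltW CN).
  rewrite lerXn2r ?nnegrE// ?le_max ?lexx//.
  have [Kx|/phi0 ->] := pselect (K x); last by rewrite normr0 lexx.
  by rewrite phiC// orbT.
apply/(integrable_mkcond _ mE).
move/(integrable_mkcond _ mEB) : iEB; congr (is_true (integrable _ _ _)).
apply/funext => x; rewrite !patchE in_setI /=.
have [xE|] := boolP (x \in E) => //=.
have [//|] := boolP (x \in B).
rewrite notin_setE => xB; rewrite phi0 ?expr0n//.
by move/KB.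
Qed.

Lemma test_function_in_H10 E phi :
  measurable E -> test_function E phi -> in_H10 E phi.
Proof.
move=> mE tphi; split; first exact: test_function_in_L2.
exists (fun=> phi), (fun x => \row_i partial i phi x); split=> //.
- move=> i; rewrite (_ : component _ _ = partial i phi).
    exact/test_function_in_L2/test_function_partial.
  by apply/funext => x; rewrite /component mxE.
- rewrite (_ : L2_sqnorm _ _ = 0); first exact: cvg_cst.
  rewrite /L2_sqnorm -[RHS](mul0r (fine (leb E))) -Rintegral_cst//.
  by apply: eq_Rintegral => x _; rewrite /= subrr expr0n.
- rewrite (_ : L2V_sqnorm _ _ = 0); first exact: cvg_cst.
  rewrite /L2V_sqnorm -[RHS](mul0r (fine (leb E))) -Rintegral_cst//.
  apply: eq_Rintegral => x _; rewrite /= /dotV big1// => i _.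
  by rewrite !mxE subrr mul0r.
Qed.

End test_functions.

(** * Pointwise ellipticity of the diffusion tensor *)

Section pointwise_ellipticity.
Context {R : realType} {d : nat}.
Local Notation leb := (lebesgue_rV R d).
Implicit Types (E Omega : set 'rV[R]_d) (x y : 'rV[R]_d) (A : 'M[R]_d).

Lemma rat_dense_ge0 (F : 'rV[R]_d -> R) : continuous F ->
  (forall r : 'rV[rat]_d, 0 <= F (map_mx ratr r)) -> forall y, 0 <= F y.
Proof.
move=> cF F0 y; rewrite leNgt; apply/negP => Fy.
have oF : open (F @^-1` [set t | t < 0]).
  by apply: open_comp => [x _|]; [exact: cF|exact: open_lt].
have [q [_ qO]] := open_rat_box oF Fy.
have : F (map_mx ratr q.1) < 0.
  by apply: qO => i; rewrite mxE subrr normr0 invr_ge0 ler0n.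
by rewrite ltNge F0.
Qed.

Lemma dotV_ge0 y : 0 <= dotV y y.
Proof. by apply: sumr_ge0 => i _; rewrite -expr2 sqr_ge0. Qed.

Lemma dotVC x y : dotV x y = dotV y x.
Proof. by apply: eq_bigr => i _; rewrite mulrC. Qed.

Lemma enorm_sqr y : enorm y ^+ 2 = dotV y y.
Proof. by rewrite sqr_sqrtr// dotV_ge0. Qed.

Lemma dotVZ a x y : dotV (a *: x) (a *: y) = a ^+ 2 * dotV x y.
Proof. by rewrite /dotV mulr_sumr; apply: eq_bigr => i _; rewrite !mxE; ring. Qed.

Let continuous_sum (f : 'I_d -> 'rV[R]_d -> R) : (forall i, continuous (f i)) ->
  continuous (fun y => \sum_(i < d) f i y).
Proof. by move=> cf; apply: (continuous_big add_continuous) => i _; exact: cf. Qed.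

Let continuous_mul (f g : 'rV[R]_d -> R) : continuous f -> continuous g ->
  continuous (fun y => f y * g y).
Proof. by move=> cf cg y; exact: continuousM (cf y) (cg y). Qed.

Lemma continuous_quadratic_form A : continuous (fun y => dotV y (y *m A)).
Proof.
apply: continuous_sum => i; apply: continuous_mul; first exact: coord_continuous.
under eq_fun do rewrite mxE.
apply: continuous_sum => j; apply: continuous_mul; first exact: coord_continuous.
exact: cst_continuous.
Qed.

Lemma ae_forall_countType (I : countType) (P : I -> 'rV[R]_d -> Prop) :
  (forall i, {ae leb, forall x, P i x}) -> {ae leb, forall x, forall i, P i x}.
Proof.
move=> aeP.
have : {ae leb, forall x, forall n, if choice.unpickle n is Some i then P i x else True}.
  apply: ae_foralln => n; case: choice.unpickle => [i|]; first exact: aeP.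
  exact: aeW.
by apply: filterS => x Px i; have := Px (choice.pickle i); rewrite choice.pickleK.
Qed.

(** The quantifier over vectors moves inside the almost everywhere: the fields
    bump q x *: r, for rational q and r, are countably many, so one null set
    serves them all, and the inequality passes from rational r to every vector
    by continuity. *)
Lemma ae_elliptic Omega (c : coefficients R d) (lo hi : R) : open Omega ->
  (forall v : 'rV[R]_d -> 'rV[R]_d, (forall i, in_H10 Omega (component v i)) ->
    {ae leb, forall x, Omega x ->
      lo * enorm (v x) ^+ 2 <= dotV (v x) (kappaV c x (v x))
        <= hi * enorm (v x) ^+ 2}) ->
  {ae leb, forall x, Omega x -> forall y,
    lo * dotV y y <= dotV y (kappaV c x y) <= hi * dotV y y}.
Proof.
move=> oO ell; have mO := open_measurable_rV oO.
pose P (i : ('rV[rat]_d * nat) * 'rV[rat]_d) x :=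
  closed_rat_box i.1 `<=` Omega -> rat_box i.1 x ->
  let y := map_mx ratr i.2 : 'rV[R]_d in
  lo * dotV y y <= dotV y (kappaV c x y) <= hi * dotV y y.
have /ae_forall_countType : forall i, {ae leb, forall x, P i x}.
  move=> [q r]; rewrite /P/=; set y := map_mx ratr r.
  have [qO|qO] := pselect (closed_rat_box q `<=` Omega); last exact: aeW.
  have /ell : forall i, in_H10 Omega (component (fun x => bump q x *: y) i).
    move=> i; apply: test_function_in_H10 => //.
    rewrite (_ : component _ _ = fun x => y 0 i * bump q x).
      exact: test_function_bump.
    by apply/funext => x; rewrite /component mxE mulrC.
  apply: filterS => x + _ xq.
  have Ox : Omega x by apply: qO => i; exact/ltW/xq.
  have b0 : 0 < bump q x ^+ 2 by rewrite exprn_gt0// bump_gt0.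
  move=> /(_ Ox); rewrite enorm_sqr /kappaV -scalemxAl !dotVZ.
  by rewrite !(mulrCA _ (bump q x ^+ 2)) !ler_pM2l.
apply: filterS => x Px Ox y.
have [q [xq qO]] := open_rat_box oO Ox.
(* Each of the two inequalities says that a quadratic form in y is nonnegative. *)
have cQ s t A : continuous (fun y => s * dotV y (y *m A) - t * dotV y y).
  rewrite (_ : (fun _ => _) = fun y => dotV y (y *m (s *: A - t%:M))).
    exact: continuous_quadratic_form.
  apply/funext => z; rewrite mulmxBr -scalemxAr mul_mx_scalar /dotV.
  rewrite !mulr_sumr -sumrB; apply: eq_bigr => i _.
  by rewrite !mxE; ring.
apply/andP; split.
- have := @rat_dense_ge0 _ (cQ 1 lo (kappa c x)^T) _ y.
  rewrite mul1r subr_ge0; apply => r.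
  by rewrite mul1r subr_ge0; have /andP[] := Px (q, r) qO xq.
- have := @rat_dense_ge0 _ (cQ (-1) (- hi) (kappa c x)^T) _ y.
  rewrite mulN1r mulNr opprK addrC subr_ge0; apply => r.
  rewrite mulN1r mulNr opprK addrC subr_ge0.
  by have /andP[] := Px (q, r) qO xq.
Qed.

End pointwise_ellipticity.

(** * Coercivity of the local forms *)

Section ae_Rintegral.
Context d (T : measurableType d) (R : realType) (m : {measure set T -> \bar R}).
Implicit Types (D : set T) (f g : T -> R).

(** f agrees almost everywhere with its absolute value. *)
Lemma ae_Rintegral_ge0 D f : measurable D -> measurable_fun D f ->
  {ae m, forall x, D x -> 0 <= f x} -> 0 <= \int[m]_(x in D) f x.
Proof.
move=> mD mf f0; rewrite /Rintegral (@ae_eq_integral _ _ _ _ _ (EFin \o (fun x => `|f x|))).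
- by rewrite fine_ge0// integral_ge0// => x _; rewrite lee_fin.
- exact: mD.
- exact/measurable_EFinP.
- by apply/measurable_EFinP; exact: measurableT_comp.
by apply: filterS f0 => x f0 Dx; rewrite /= ger0_norm ?f0.
Qed.

Lemma ae_le_Rintegral D f g : measurable D ->
  m.-integrable D (EFin \o f) -> m.-integrable D (EFin \o g) ->
  {ae m, forall x, D x -> f x <= g x} ->
  \int[m]_(x in D) f x <= \int[m]_(x in D) g x.
Proof.
move=> mD fi gi fg; rewrite -subr_ge0 -RintegralB//; apply: ae_Rintegral_ge0 => //.
  by apply: measurable_funB; apply/measurable_EFinP; apply: measurable_int; eassumption.
by apply: filterS fg => x fg Dx; rewrite subr_ge0 fg.
Qed.

Lemma ae_integrable_bound D f g : measurable D -> measurable_fun D f ->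
  {ae m, forall x, D x -> 0 <= f x <= g x} ->
  m.-integrable D (EFin \o g) -> m.-integrable D (EFin \o f).
Proof.
move=> mD mf fg /integrableP[/measurable_EFinP mg goo].
apply/integrableP; split; first exact/measurable_EFinP.
apply: le_lt_trans goo; apply: ae_ge0_le_integral => //.
- by do 2! apply: measurableT_comp => //.
- by do 2! apply: measurableT_comp => //.
apply: filterS fg => x fg Dx; have /andP[f0 fgx] := fg Dx.
by rewrite /= lee_fin !ger0_norm// (le_trans f0).
Qed.

End ae_Rintegral.

Section coercivity.
Context {R : realType} {d : nat}.
Local Notation leb := (lebesgue_rV R d).
Implicit Types (E Omega : set 'rV[R]_d) (v : 'rV[R]_d -> R).

Lemma grad_in_L2 E v i : in_H1 E v -> in_L2 E (component (grad E v) i).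
Proof. by move=> [_ H]; have [+ _] := xgetPex (fun=> 0) H; exact. Qed.

Lemma L2V_sqnorm_ge0 E (G : 'rV[R]_d -> 'rV[R]_d) : 0 <= L2V_sqnorm E G.
Proof. by apply: Rintegral_ge0 => x _; exact: dotV_ge0. Qed.

Lemma L2_sqnorm_eq0 E v : measurable E -> in_L2 E v -> L2_sqnorm E v <= 0 ->
  {ae leb, forall x, E x -> v x = 0}.
Proof.
move=> mE [mv iv] v0.
have : (\int[leb]_(x in E) `|(v x ^+ 2)%:E| = 0)%E.
  under eq_integral do rewrite gee0_abs ?lee_fin ?sqr_ge0//.
  apply/eqP; rewrite eq_le integral_ge0 ?andbT; last first.
    by move=> x _; rewrite lee_fin sqr_ge0.
  by rewrite -(fineK (integrable_fin_num _ iv))// lee_fin.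
move/ae_eq_integral_abs => /(_ mE) H.
have /H : measurable_fun E (fun x => (v x ^+ 2)%:E) by exact: measurable_int iv.
apply: filterS => x v2 Ex; have /eqP := v2 Ex.
by rewrite /= eqe sqrf_eq0 => /eqP.
Qed.

(** The gradient term is compared pointwise with kappa_lo |grad v|^2 and the
    reaction term is nonnegative. The upper ellipticity bound is what makes the
    gradient term integrable; without integrability the real-valued integral
    would be 0 instead of infinite, and the comparison would fail. *)
Lemma a_loc_coercive Omega (c : coefficients R d) (lo hi mu0 : R) E v :
  continuous_problem Omega c lo hi mu0 -> open E -> E `<=` Omega ->
  in_H1 E v -> lo * L2V_sqnorm E (grad E v) <= a_loc c E v v.
Proof.
move=> cp oE EO vH1.
have [[oO _ _ _ _] mk _ [mgam _] _ [mdiv _] _ _ lo0 _ ell mu00 mu_ge] := cp.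
have mE := open_measurable_rV oE; have mO := open_measurable_rV oO.
have gL2 i := grad_in_L2 i vH1; have [[mv _] _] := vH1.
have mg i : measurable_fun E (fun x => grad E v x 0 i) := (gL2 i).1.
have inE (P : 'rV[R]_d -> Prop) : {ae leb, forall x, Omega x -> P x} ->
    {ae leb, forall x, E x -> P x}.
  by apply: filterS => x Px Ex; exact/Px/EO.
have measE (f : 'rV[R]_d -> R) : measurable_fun Omega f -> measurable_fun E f.
  exact: measurable_funS.
have ellE := inE _ (ae_elliptic oO ell).
pose k x := dotV (kappaV c x (grad E v x)) (grad E v x).
pose n x := dotV (grad E v x) (grad E v x).
have mk' : measurable_fun E k.
  apply: measurable_sum => i; apply: measurable_funM => //.
  under eq_fun do rewrite mxE.
  apply: measurable_sum => j; apply: measurable_funM => //.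
  by under eq_fun do rewrite mxE; exact: measE (mk i j).1.
have intn : leb.-integrable E (EFin \o n).
  rewrite (_ : _ \o _ = fun x => (\sum_(i < d) (component (grad E v) i x ^+ 2)%:E)%E).
    by apply: integrable_sum => // i _; exact: (gL2 i).2.
  by apply/funext => x /=; rewrite sumEFin.
have intZ a : leb.-integrable E (EFin \o (fun x => a * n x)).
  exact: (integrableZl mE a intn).
have intk : leb.-integrable E (EFin \o k).
  apply: ae_integrable_bound (intZ hi) => //.
  apply: filterS ellE => x ellx Ex; have /andP[ge le] := ellx Ex (grad E v x).
  rewrite /k dotVC le andbT; apply: le_trans ge.
  by rewrite mulr_ge0 ?dotV_ge0// ltW.
rewrite /a_loc -[leLHS]addr0; apply: lerD.
  rewrite /L2V_sqnorm -RintegralZl//; apply: ae_le_Rintegral => //.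
  apply: filterS ellE => x ellx Ex; have /andP[ge le] := ellx Ex (grad E v x).
  by rewrite /k dotVC.
apply: ae_Rintegral_ge0 => //.
  apply: measurable_funM => //; apply: measurable_funM => //; apply: measE.
  by apply: measurable_funB => //; exact: measurable_funM.
apply: filterS (inE _ mu_ge) => x mux Ex.
by rewrite -mulrA -expr2 mulr_ge0 ?sqr_ge0// (le_trans mu00)// mux.
Qed.

End coercivity.

(** * Unique solvability of the discrete problem *)

Theorem theorem3p2 (R : realType) (d : nat) (d_eq2_or_3 : d = 2%N \/ d = 3%N)
    (Omega : set 'rV[R]_d) (c : coefficients R d)
    (kappa_lo kappa_hi mu0 : R)
    (Hcp : continuous_problem Omega c kappa_lo kappa_hi mu0)
    (h : R) (k : nat) (I : finType) (T : I -> set 'rV[R]_d)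
    (V : vectType R) (rep : {linear V -> ('rV[R]_d -> R^o)})
    (A : {biscalar V}) (A_E a_E b_E : I -> {biscalar V}) (f : {scalar V})
    (HA1 : assumption_A1 rep T Omega h k A A_E)
    (HA2 : assumption_A2 rep T c k A_E a_E b_E) :
  exists! u : V, forall v : V, sum_form a_E u v + sum_form b_E u v = f v.
Proof.
apply: definite_form_solvable.
- move=> u a v w /=; rewrite /sum_form -!big_split mulr_sumr -big_split /=.
  by apply: eq_bigr => i _; rewrite !linearPr /=; ring.
- move=> u a v w /=; rewrite /sum_form -!big_split mulr_sumr -big_split /=.
  by apply: eq_bigr => i _; rewrite !linearPl /=; ring.
move=> u /(_ u).
have [oO _ _ _ _] := cp_domain Hcp.
have [_ _ [simT subT _ _ _ _ _] inj H1 [C PF] _ _ _] := HA1.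
have [_ _ _ _ _ _ [alo [ahi [Cb [alo0 _ _ stab]]]]] := HA2.
have oT i : open (T i) by have [[]] := simT i.
have gradT i : alo * (kappa_lo * L2V_sqnorm (T i) (grad (T i) (rep u))) <= a_E i u u.
  have [+ _ _ _] := stab i u u; apply: le_trans; rewrite ler_pM2l//.
  by apply: (a_loc_coercive Hcp) => //; have [_] := H1 u.
have lo0 := cp_kappa_lo Hcp.
rewrite /sum_form [X in _ + X]big1 ?addr0; last first.
  by move=> i _; have [_ _ ->] := stab i u u.
move=> au0.
have a0 : alo * (kappa_lo * broken_sqnorm T (rep u)) <= 0.
  by rewrite -au0 !mulr_sumr; apply: ler_sum.
have br0 : broken_sqnorm T (rep u) = 0.
  apply/eqP; rewrite eq_le sumr_ge0 ?andbT; last by move=> *; exact: L2V_sqnorm_ge0.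
  by move: a0; rewrite !pmulr_rle0.
apply: inj; apply: L2_sqnorm_eq0; first exact: open_measurable_rV.
  by have [] := H1 u.
by apply: le_trans (PF u) _; rewrite br0 mulr0.
Qed.
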